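(* Let $K\subseteq L$ be a finite Galois field extension and let $C\subseteq L^n$ be an $L$-linear code. Let $M(C)$ be the $q$-matroid associated to $C$ and $C^\perp=\{\mathbf{x}\in L^n:\mathbf{x}\cdot\mathbf{c}=0\ \forall \mathbf{c}\in C\}$ the dual code. Then $M(C)^*=M(C^\perp)$.
   Context: A $q$-matroid is a pair $(E,r)$ where $E$ is a finite dimensional vector space over a field and $r$ is an integer-valued function on the subspaces of $E$ satisfying (r1) $0\le r(A)\le\dim A$, (r2) $A\subseteq B\Rightarrow r(A)\le r(B)$, (r3) $r(A+B)+r(A\cap B)\le r(A)+r(B)$. For an $L$-linear code $C\subseteq L^n$, $M(C)=(K^n,r)$ where for a $K$-linear subspace $J\subseteq K^n$ with generator matrix $Y$ (rows a $K$-basis of $J$), $r(J)=\dim_L\{\mathbf{c}Y^T:\mathbf{c}\in C\}$ (independent of the choice of $Y$). The dual of a $q$-matroid $(E,r)$ with $E=K^n$ is $(E,r^* )$ with $r^*(A)=\dim A-r(E)+r(A^\perp)$, where $A^\perp$ is the orthogonal complement with respect to the standard bilinear form on $K^n$. *)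

(* Defs.v *)
From HB Require Import structures.
From mathcomp Require Import all_boot all_order all_algebra all_field zify.

Set Implicit Arguments.
Unset Strict Implicit.
Unset Printing Implicit Defensive.

Import Order.TTheory GRing.Theory Num.Theory.
Local Open Scope ring_scope.

Record qmatroid (K : fieldType) (E : vectType K) := QMatroid {
  qrank :> {vspace E} -> int;
  qrank_bounds : forall A, 0 <= qrank A <= (\dim A)%:Z;
  qrank_mono : forall A B, (A <= B)%VS -> qrank A <= qrank B;
  qrank_submod : forall A B,
    qrank (A + B)%VS + qrank (A :&: B)%VS <= qrank A + qrank B }.

Lemma dim_rV (F : fieldType) n : \dim (fullv : {vspace 'rV[F]_n}) = n.
Proof. by rewrite dimvf /dim /= mul1n. Qed.

Lemma dim_subr (a b c : nat) : (a + b = c)%N -> b%:Z = c%:Z - a%:Z.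
Proof. by lia. Qed.

Section Orthogonal.

Variables (F : fieldType) (n : nat).
Implicit Types (A B : {vspace 'rV[F]_n}) (x y : 'rV[F]_n).

Definition dotv x y : F := \sum_(i < n) x 0 i * y 0 i.

Definition seq_mx m (b : m.-tuple 'rV[F]_n) : 'M[F]_(m, n) :=
  \matrix_(i < m) tnth b i.

Definition gen_mx A : 'M[F]_(\dim A, n) := seq_mx (vbasis A).

Definition mulT_lfun m (Y : 'M[F]_(m, n)) : 'Hom('rV[F]_n, 'rV[F]_m) :=
  linfun (mulmxr Y^T).

(* [memv_orthv] below is the usual description of the orthogonal complement. *)
Definition orthv A : {vspace 'rV[F]_n} := lker (mulT_lfun (gen_mx A)).

Lemma mul_seq_mxT m (b : m.-tuple 'rV[F]_n) x i :
  (x *m (seq_mx b)^T) 0 i = dotv x (tnth b i).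
Proof. by rewrite mxE; apply: eq_bigr => j _; rewrite !mxE. Qed.

Lemma dotvC x y : dotv x y = dotv y x.
Proof. by apply: eq_bigr => i _; rewrite mulrC. Qed.

Lemma dotvDr x y z : dotv x (y + z) = dotv x y + dotv x z.
Proof. by rewrite -big_split; apply: eq_bigr => i _; rewrite !mxE mulrDr. Qed.

Lemma dotvZr x a y : dotv x (a *: y) = a * dotv x y.
Proof. by rewrite big_distrr; apply: eq_bigr => i _; rewrite !mxE mulrCA. Qed.

Lemma dotv0r x : dotv x 0 = 0.
Proof. by rewrite /dotv big1 // => i _; rewrite !mxE mulr0. Qed.

Lemma memv_orthv A x :
  reflect (forall a, a \in A -> dotv x a = 0) (x \in orthv A).
Proof.
rewrite memv_ker lfunE /=; apply: (iffP eqP) => [x0 a Aa | x0].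
  rewrite (coord_vbasis Aa).
  elim/big_rec: _ => [|i y _ y0]; first exact: dotv0r.
  by rewrite dotvDr y0 addr0 dotvZr -tnth_nth -mul_seq_mxT x0 mxE mulr0.
apply/rowP=> i; rewrite mul_seq_mxT mxE.
by apply: x0; apply: vbasis_mem; apply: mem_tnth.
Qed.

Lemma gen_mx_free A : row_free (gen_mx A).
Proof.
apply/inj_row_free => w; rewrite mulmx_sum_row => w0.
have /freeP/(_ (fun i => w 0 i)) fr := basis_free (vbasisP A).
apply/rowP=> i; rewrite mxE; apply: fr; rewrite -[RHS]w0.
by apply: eq_bigr => j _; rewrite rowK -tnth_nth.
Qed.

Lemma dim_orthv A : (\dim (orthv A) + \dim A = n)%N.
Proof.
have := limg_ker_dim (mulT_lfun (gen_mx A)) fullv.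
rewrite capfv dim_rV.
suff -> : limg (mulT_lfun (gen_mx A)) = fullv by rewrite dim_rV.
apply/eqP; rewrite eqEsubv subvf; apply/subvP => w _.
have /submxP[x ->] : (w <= (gen_mx A)^T)%MS.
  by apply: submx_full; rewrite /row_full mxrank_tr; apply: gen_mx_free.
by have := memv_img (mulT_lfun (gen_mx A)) (memvf x); rewrite lfunE.
Qed.

Lemma orthvS A B : (A <= B)%VS -> (orthv B <= orthv A)%VS.
Proof.
move/subvP=> AB; apply/subvP => x /memv_orthv xB.
by apply/memv_orthv => a /AB; apply: xB.
Qed.

Lemma orthvD A B : orthv (A + B)%VS = (orthv A :&: orthv B)%VS.
Proof.
apply/eqP; rewrite eqEsubv subv_cap !orthvS ?addvSl ?addvSr //=.
apply/subvP=> x /memv_capP[/memv_orthv xA /memv_orthv xB].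
by apply/memv_orthv => _ /memv_addP[a Aa [b Bb ->]]; rewrite dotvDr xA ?xB ?addr0.
Qed.

Lemma orthvK A : orthv (orthv A) = A.
Proof.
apply/esym/eqP; rewrite eqEdim; apply/andP; split; last first.
  by have := dim_orthv A; have := dim_orthv (orthv A); lia.
apply/subvP => a Aa; apply/memv_orthv => x /memv_orthv xA.
by rewrite dotvC xA.
Qed.

Lemma orthvI A B : orthv (A :&: B)%VS = (orthv A + orthv B)%VS.
Proof. by rewrite -[RHS]orthvK orthvD !orthvK. Qed.

Lemma orthv_fullv : orthv fullv = 0%VS.
Proof.
apply/eqP; rewrite -dimv_eq0; apply/eqP.
by have := dim_orthv fullv; rewrite dim_rV; lia.
Qed.

End Orthogonal.

Section Dual.

Variables (K : fieldType) (n : nat) (M : qmatroid 'rV[K]_n).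
Implicit Types A B : {vspace 'rV[K]_n}.

Definition dual_rank A : int := (\dim A)%:Z - M fullv + M (orthv A).

Lemma qrank_lip A B : (A <= B)%VS ->
  M B <= M A + ((\dim B)%:Z - (\dim A)%:Z).
Proof.
move=> sAB; pose D := (B :\: A)%VS.
have eB : (A + D)%VS = B.
  by rewrite addvC -[RHS](addv_diff_cap B A) (capv_idPr sAB).
have := qrank_submod M A D; rewrite eB.
have := dimv_cap_compl B A; rewrite (capv_idPr sAB) -/D.
by have := qrank_bounds M D; have := qrank_bounds M (A :&: D)%VS; lia.
Qed.

Lemma dual_rank_bounds A : 0 <= dual_rank A <= (\dim A)%:Z.
Proof.
have := qrank_lip (subvf (orthv A)); have := qrank_mono M (subvf (orthv A)).
have := dim_orthv A; rewrite /dual_rank dim_rV; lia.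
Qed.

Lemma dual_rank_mono A B : (A <= B)%VS -> dual_rank A <= dual_rank B.
Proof.
move=> sAB; have := qrank_lip (orthvS sAB); rewrite /dual_rank.
by have := dim_orthv A; have := dim_orthv B; lia.
Qed.

Lemma dual_rank_submod A B :
  dual_rank (A + B)%VS + dual_rank (A :&: B)%VS <= dual_rank A + dual_rank B.
Proof.
rewrite /dual_rank orthvD orthvI.
by have := qrank_submod M (orthv A) (orthv B); have := dimv_sum_cap A B; lia.
Qed.

Definition dual_qmatroid : qmatroid 'rV[K]_n :=
  QMatroid dual_rank_bounds dual_rank_mono dual_rank_submod.

End Dual.

Section Code.

Variables (K : fieldType) (L : fieldExtType K) (n : nat).
Implicit Types (C : {vspace 'rV[L]_n}) (J A B : {vspace 'rV[K]_n}).

(* The L-space of all c *m Y^T, c in C, with the entries of Y seen in L. *)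
Definition code_img m C (Y : 'M[K]_(m, n)) : {vspace 'rV[L]_m} :=
  (mulT_lfun (map_mx (in_alg L) Y) @: C)%VS.

Definition code_rank C J : int := (\dim (code_img C (gen_mx J)))%:Z.

Definition lift_rV (y : 'rV[K]_n) : 'rV[L]_n := map_mx (in_alg L) y.

Lemma map_seq_mx m (b : m.-tuple 'rV[K]_n) :
  map_mx (in_alg L) (seq_mx b) = seq_mx (map_tuple lift_rV b).
Proof. by apply/matrixP=> i j; rewrite !mxE tnth_map mxE. Qed.

Definition shortening C J : {vspace 'rV[L]_n} :=
  (C :&: lker (mulT_lfun (map_mx (in_alg L) (gen_mx J))))%VS.

Lemma mem_lker_basis m (b : m.-tuple 'rV[K]_n) J x : basis_of J b ->
  reflect (forall y, y \in J -> dotv x (lift_rV y) = 0)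
          (x \in lker (mulT_lfun (map_mx (in_alg L) (seq_mx b)))).
Proof.
move=> bJ; rewrite memv_ker lfunE /= map_seq_mx.
apply: (iffP eqP) => [x0 y Jy | x0].
  rewrite (coord_basis bJ Jy).
  elim/big_rec: _ => [|i z _ z0]; first by rewrite /lift_rV map_mx0 dotv0r.
  rewrite /lift_rV map_mxD map_mxZ dotvDr z0 addr0 dotvZr -tnth_nth.
  have := congr1 (fun v : 'rV_m => v 0 i) x0.
  by rewrite mul_seq_mxT tnth_map mxE => ->; rewrite mulr0.
apply/rowP=> i; rewrite mul_seq_mxT tnth_map mxE.
by apply: x0; apply: (basis_mem bJ); apply: mem_tnth.
Qed.

Lemma mem_shortening C J x :
  reflect (x \in C /\ forall y, y \in J -> dotv x (lift_rV y) = 0)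
          (x \in shortening C J).
Proof.
rewrite memv_cap; apply: (iffP andP) => -[xC xJ]; split=> //.
  exact/(mem_lker_basis _ (vbasisP J)).
exact/(mem_lker_basis _ (vbasisP J)).
Qed.

Lemma code_rankE C J : code_rank C J = (\dim C)%:Z - (\dim (shortening C J))%:Z.
Proof.
exact/dim_subr/limg_ker_dim.
Qed.

(* The rank does not depend on the basis of J used as generator matrix. *)
Lemma code_rank_basis C J m (b : m.-tuple 'rV[K]_n) : basis_of J b ->
  code_rank C J = (\dim (code_img C (seq_mx b)))%:Z.
Proof.
move=> bJ; rewrite code_rankE.
have /dim_subr -> := limg_ker_dim (mulT_lfun (map_mx (in_alg L) (seq_mx b))) C.
congr (_ - Posz (\dim _)).
apply/vspaceP => x; rewrite [RHS]memv_cap.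
apply/mem_shortening/andP => -[xC xJ]; split=> //; exact/(mem_lker_basis _ bJ).
Qed.

Lemma code_rank_bounds C J : 0 <= code_rank C J <= (\dim J)%:Z.
Proof.
rewrite /code_rank lez_nat /=.
by rewrite (leq_trans (dimvS (subvf _))) // dim_rV.
Qed.

Lemma shorteningS C A B :
  (A <= B)%VS -> (shortening C B <= shortening C A)%VS.
Proof.
move/subvP=> AB; apply/subvP => x /mem_shortening[xC xB].
by apply/mem_shortening; split=> // a /AB; apply: xB.
Qed.

Lemma code_rank_mono C A B :
  (A <= B)%VS -> code_rank C A <= code_rank C B.
Proof. by move=> /(shorteningS C)/dimvS; rewrite !code_rankE; lia. Qed.

Lemma code_rank_submod C A B :
  code_rank C (A + B)%VS + code_rank C (A :&: B)%VS
    <= code_rank C A + code_rank C B.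
Proof.
rewrite !code_rankE; have := dimv_sum_cap (shortening C A) (shortening C B).
have -> : (shortening C A :&: shortening C B)%VS = shortening C (A + B)%VS.
  apply/eqP; rewrite eqEsubv subv_cap !shorteningS ?addvSl ?addvSr //= andbT.
  apply/subvP=> x /memv_capP[/mem_shortening[xC xA] /mem_shortening[_ xB]].
  apply/mem_shortening; split=> // _ /memv_addP[a Aa [b Bb ->]].
  by rewrite /lift_rV map_mxD dotvDr xA ?xB ?addr0.
have /dimvS : (shortening C A + shortening C B <= shortening C (A :&: B))%VS.
  by rewrite subv_add !shorteningS ?capvSl ?capvSr.
lia.
Qed.

Definition code_qmatroid C : qmatroid 'rV[K]_n :=
  QMatroid (code_rank_bounds C) (@code_rank_mono C) (code_rank_submod C).

End Code.

(* Main.v *)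
Require Import Defs.
From mathcomp Require Import all_boot all_order all_algebra all_field.
From mathcomp Require Import zify.
From Stdlib Require Import FunctionalExtensionality ProofIrrelevance.

(** Write [V J] for the annihilator in [L^n] of the lift of [J <= K^n]. It has
    dimension [n - dim J], and [(V J)^perp = V (J^perp)]. Both [r^*(A)] and the
    rank of [A] in [M(C^perp)] then equal [dim A - dim (C :&: V (A^perp))]: for
    the latter, [C^perp :&: V A = (C + V (A^perp))^perp]. *)

Set Implicit Arguments.
Unset Strict Implicit.
Unset Printing Implicit Defensive.

Import GRing.Theory.
Local Open Scope ring_scope.

(** The records also carry proofs of the axioms, which proof irrelevance identifies. *)
Lemma qmatroid_ext (K : fieldType) (E : vectType K) (M N : qmatroid E) :
  (forall A, M A = N A) -> M = N.
Proof.
case: M N => [r b m s] [r' b' m' s'] /= /functional_extensionality rr'.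
by subst r'; congr QMatroid; apply: proof_irrelevance.
Qed.

(** Numerical form of [(U + V) / U] being isomorphic to [V / (U :&: V)], since [orthv] turns
    dimension into codimension. *)
Lemma dim_orthv_subr (F : fieldType) n (U V : {vspace 'rV[F]_n}) :
  (\dim (orthv U))%:Z - (\dim (orthv (U + V)%VS))%:Z
    = (\dim V)%:Z - (\dim (U :&: V))%:Z.
Proof.
have := dimv_sum_cap U V.
by have := dim_orthv (U + V)%VS; have := dim_orthv U; lia.
Qed.

Section LiftedAnnihilator.

Variables (K : fieldType) (L : fieldExtType K) (n : nat).
Implicit Types (C : {vspace 'rV[L]_n}) (A J : {vspace 'rV[K]_n}).

Lemma dotv_lift_rV (x y : 'rV[K]_n) :
  dotv (lift_rV L x) (lift_rV L y) = in_alg L (dotv x y).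
Proof.
by rewrite /dotv rmorph_sum; apply: eq_bigr => i _; rewrite !mxE rmorphM.
Qed.

(** This is [V J]; as a shortening of the full code it inherits [mem_shortening]. *)
Definition lift_orthv J : {vspace 'rV[L]_n} := shortening fullv J.

Lemma shorteningE C J : shortening C J = (C :&: lift_orthv J)%VS.
Proof. by rewrite /lift_orthv /shortening capfv. Qed.

(** Matrix rank is unchanged by field extension, so a [K]-basis of [J] stays independent over
    [L]. *)
Lemma dim_lift_orthv J : (\dim (lift_orthv J) + \dim J = n)%N.
Proof.
set Y := map_mx (in_alg L) (gen_mx J).
have := limg_ker_dim (mulT_lfun Y) fullv; rewrite dim_rV -/(lift_orthv J).
suff -> : limg (mulT_lfun Y) = fullv by rewrite dim_rV.
apply/eqP; rewrite eqEsubv subvf; apply/subvP => w _.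
have /submxP[x ->] : (w <= Y^T)%MS.
  apply: submx_full; rewrite /row_full mxrank_tr mxrank_map.
  exact: gen_mx_free.
by have := memv_img (mulT_lfun Y) (memvf x); rewrite lfunE.
Qed.

Lemma dim_lift_orthv_orthv A : \dim (lift_orthv (orthv A)) = \dim A.
Proof.
apply/eqP; rewrite -(eqn_add2l (\dim (orthv A))) dim_orthv addnC.
by rewrite dim_lift_orthv.
Qed.

Lemma orthv_lift_orthv A : orthv (lift_orthv A) = lift_orthv (orthv A).
Proof.
(* After removing one [orthv], both sides have dimension [n - \dim A], so one inclusion suffices. *)
rewrite -[RHS]orthvK; congr orthv; apply/esym/eqP; rewrite eqEdim.
apply/andP; split; last first.
  rewrite -(leq_add2r (\dim A)) dim_lift_orthv -dim_lift_orthv_orthv.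
  by rewrite dim_orthv.
apply/subvP => x /memv_orthv x0; apply/mem_shortening; split=> [|a Aa].
  exact: memvf.
(* The lift of [a] lies in [lift_orthv (orthv A)], so [x] is orthogonal to it. *)
apply: x0; apply/mem_shortening; split=> [|y /memv_orthv y0].
  exact: memvf.
by rewrite dotv_lift_rV dotvC y0 // rmorph0.
Qed.

(** Only 0 annihilates the lift of all of [K^n]. *)
Lemma code_rank_fullv C : code_rank C fullv = (\dim C)%:Z.
Proof.
rewrite code_rankE shorteningE.
suff /eqP : \dim (lift_orthv fullv) = 0%N.
  by rewrite dimv_eq0 => /eqP ->; rewrite capv0 dimv0 subr0.
by have := dim_lift_orthv fullv; rewrite dim_rV; lia.
Qed.

Lemma code_rank_orthv C A :
  code_rank (orthv C) A = (\dim A)%:Z - (\dim (shortening C (orthv A)))%:Z.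
Proof.
have -> : code_rank (orthv C) A
  = (\dim (orthv C))%:Z - (\dim (orthv (C + lift_orthv (orthv A))))%:Z.
  by rewrite code_rankE shorteningE orthvD -orthv_lift_orthv orthvK.
by rewrite shorteningE dim_orthv_subr dim_lift_orthv_orthv.
Qed.

End LiftedAnnihilator.

Theorem theorem7p8 (K : fieldType) (L : splittingFieldType K)
    (galLK : galois 1%VS {:L}%VS) (n : nat) (C : {vspace 'rV[L]_n}) :
  dual_qmatroid (code_qmatroid C) = code_qmatroid (orthv C).
Proof.
apply: qmatroid_ext => A; rewrite /= code_rank_orthv /dual_rank /=.
(* The two occurrences of [\dim C] in the dual rank cancel. *)
by rewrite code_rank_fullv code_rankE addrA subrK.
Qed.
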